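(* Let $M$ be a linearly orderable (commutative) monoid, and let $\mathcal{P}_{\mathrm{fin}}(M)$ be its finitary power monoid. Then the following statements hold. (1) If $M$ satisfies the quasi-ACCP, then $\mathcal{P}_{\mathrm{fin}}(M)$ also satisfies the quasi-ACCP. (2) If $M$ satisfies the almost ACCP, then $\mathcal{P}_{\mathrm{fin}}(M)$ also satisfies the almost ACCP.
   Context: All monoids are commutative and written additively, with identity $0$. A monoid $M$ is linearly orderable if there is a total order $\preceq$ on $M$ such that $b \prec c$ implies $b+d \prec c+d$ for all $b,c,d \in M$. The finitary power monoid $\mathcal{P}_{\mathrm{fin}}(M)$ is the monoid of all nonempty finite subsets of $M$ under $S+T := \{s+t : s \in S, t \in T\}$ (identity $\{0\}$; in general it is not cancellative). For a monoid $H$: $\mathcal{U}(H)$ is the group of invertible elements; $c$ divides $b$ in $H$ if $b = c+d$ for some $d \in H$; a common divisor of a subset of $H$ is an element dividing every element of that subset. An atom is an element $a \in H \setminus \mathcal{U}(H)$ such that $a = b+c$ with $b,c \in H$ implies $b \in \mathcal{U}(H)$ or $c \in \mathcal{U}(H)$. An element is atomic if it is invertible or a finite sum of atoms. A principal ideal is a set of the form $b+H$. An element $b \in H$ satisfies the ACCP if every ascending chain of principal ideals of $H$ containing the ideal $b+H$ as a term stabilizes (equivalently, every ascending chain of principal ideals starting at $b+H$ stabilizes). $H$ satisfies the quasi-ACCP (resp., the almost ACCP) if for every nonempty finite subset $S$ of $H$ there exist a common divisor (resp., an atomic common divisor) $d \in H$ of $S$, an element $s \in S$, and an element $t \in H$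 with $s = d + t$ (that is, $t = s-d$) such that $t$ satisfies the ACCP. *)

(* Defs.v *)
From HB Require Import structures.
From mathcomp Require Import all_boot all_order all_algebra finmap.
From mathcomp Require Import classical_sets.
Set Implicit Arguments.
Unset Strict Implicit.
Unset Printing Implicit Defensive.

Import GRing.Theory.
Local Open Scope fset_scope.
Local Open Scope classical_set_scope.
Local Open Scope ring_scope.

(* Commutative additive monoids are MathComp's nmodType. *)

(* Totality of le includes reflexivity. *)
Definition linearly_orderable (M : nmodType) : Prop :=
  exists le : rel M,
    let lt b c := (b != c) && le b c in
    [/\ total le, antisymmetric le, transitive le
      & forall b c d : M, lt b c -> lt (b + d) (c + d)].

Section MonoidNotions.
Variable H : nmodType.
Implicit Types (a b c d s t : H) (S : {fset H}) (I : nat -> set H).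

Definition invertible b : Prop := exists c, b + c = 0.

Definition divides c b : Prop := exists d, b = c + d.

Definition common_divisor d S : Prop := forall s, s \in S -> divides d s.

Definition atom a : Prop :=
  ~ invertible a /\ forall b c, a = b + c -> invertible b \/ invertible c.

Definition atomic b : Prop :=
  invertible b \/
  exists2 l : seq H, (forall a, a \in l -> atom a) & b = \sum_(a <- l) a.

Definition principal_ideal b : set H := [set b + h | h in [set: H]].

Definition ascending_principal_chain I : Prop :=
  (forall n, exists b, I n = principal_ideal b) /\
  (forall n, I n `<=` I n.+1).

Definition stabilizes I : Prop := exists N, forall n, (N <= n)%N -> I n = I N.

Definition satisfies_ACCP b : Prop :=
  forall I, ascending_principal_chain I ->
    (exists n, I n = principal_ideal b) -> stabilizes I.

End MonoidNotions.

(* H need not be cancellative, so the difference s - d is rendered as some t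
   with s = d + t. *)
Definition quasi_ACCP (H : nmodType) : Prop :=
  forall S : {fset H}, S != fset0 ->
    exists d s t : H,
      [/\ common_divisor d S, s \in S, s = d + t & satisfies_ACCP t].

Definition almost_ACCP (H : nmodType) : Prop :=
  forall S : {fset H}, S != fset0 ->
    exists d s t : H,
      [/\ common_divisor d S, atomic d, s \in S, s = d + t & satisfies_ACCP t].

(* The carrier of the finitary power monoid; the monoid structure is the
   nmodType instance below. *)
Record pfin (M : nmodType) : Type :=
  Pfin { pfin_val :> {fset M}; pfin_neq0 : pfin_val != fset0 }.

HB.instance Definition _ (M : nmodType) := [isSub for @pfin_val M].
HB.instance Definition _ (M : nmodType) := [Choice of pfin M by <:].

Section FinitaryPowerMonoid.
Variable M : nmodType.
Implicit Types S T U : pfin M.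

Definition sumset (A B : {fset M}) : {fset M} :=
  [fset x + y | x in A, y in B].

Lemma sumsetP (A B : {fset M}) (z : M) :
  reflect (exists x y, [/\ x \in A, y \in B & z = x + y]) (z \in sumset A B).
Proof.
apply: (iffP (imfset2P _ _ _ _ _)) => [[x xA [y yB ->]]|[x [y [xA yB ->]]]].
  by exists x, y.
by exists x => //; exists y.
Qed.

Lemma sumset_neq0 S T : sumset S T != fset0.
Proof.
have /fset0Pn[x xS] := pfin_neq0 S; have /fset0Pn[y yT] := pfin_neq0 T.
by apply/fset0Pn; exists (x + y); apply/sumsetP; exists x, y.
Qed.

Lemma pfin1_neq0 (x : M) : [fset x] != fset0.
Proof. by apply/fset0Pn; exists x; rewrite inE. Qed.

Definition pfin_zero : pfin M := Pfin (pfin1_neq0 0).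
Definition pfin_add S T : pfin M := Pfin (sumset_neq0 S T).

Lemma pfin_addA : associative pfin_add.
Proof.
move=> S T U; apply/val_inj/fsetP => z /=; apply/sumsetP/sumsetP.
  move=> [x [_ [xS /sumsetP[y [w [yT wU ->]]] ->]]].
  by exists (x + y), w; rewrite addrA; split=> //; apply/sumsetP; exists x, y.
move=> [_ [w [/sumsetP[x [y [xS yT ->]]] wU ->]]].
by exists x, (y + w); rewrite addrA; split=> //; apply/sumsetP; exists y, w.
Qed.

Lemma pfin_addC : commutative pfin_add.
Proof.
move=> S T; apply/val_inj/fsetP => z /=.
by apply/sumsetP/sumsetP => -[x [y [xS yT ->]]]; exists y, x; rewrite addrC.
Qed.

Lemma pfin_add0 : left_id pfin_zero pfin_add.
Proof.
move=> S; apply/val_inj/fsetP => z /=; apply/sumsetP/idP.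
  by move=> [x [y []]]; rewrite inE => /eqP-> yS ->; rewrite add0r.
by move=> zS; exists 0, z; rewrite inE eqxx add0r.
Qed.

HB.instance Definition _ :=
  GRing.isNmodule.Build (pfin M) pfin_addA pfin_addC pfin_add0.

End FinitaryPowerMonoid.

(* Main.v *)
Require Import Defs.
From mathcomp Require Import all_boot all_order all_algebra finmap.
From mathcomp Require Import classical_sets.
From mathcomp Require Import boolp.
Set Implicit Arguments.
Unset Strict Implicit.
Unset Printing Implicit Defensive.

Import GRing.Theory.
Local Open Scope fset_scope.
Local Open Scope ring_scope.

(* If d divides every element of the union of a finite family of sets, then {d}
   divides every member of the family; so it is enough to show that a set T
   satisfies the ACCP in the power monoid as soon as some element t of T
   satisfies it in M.  Along a chain T_n = T_(n+1) + A_n starting at T the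
   cardinalities of the T_n are nonincreasing, hence eventually constant, and in
   a linearly ordered monoid this forces the A_n to be singletons {a_n}.
   Following t through the decompositions yields a chain t_n = t_(n+1) + a_n in
   M, so that a_n, and with it A_n, is eventually invertible. *)

(** * The ACCP in terms of divisor chains *)

Section DivisorChains.
Variable H : nmodType.
Implicit Types (b : H) (x a : nat -> H).

Lemma divides_principal_ideal b c :
  divides c b -> (principal_ideal b `<=` principal_ideal c)%classic.
Proof. by case=> d -> _ [h _ <-]; exists (d + h); rewrite ?addrA. Qed.

Lemma principal_ideal_divides b c :
  (principal_ideal b `<=` principal_ideal c)%classic -> divides c b.
Proof.
by move=> /(_ b) []; [exists 0; rewrite ?addr0 | move=> h _ <-; exists h].
Qed.

Lemma satisfies_ACCP_chain b x : satisfies_ACCP b ->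
    x 0%N = b -> (forall n, divides (x n.+1) (x n)) ->
  exists N, forall n, (N <= n)%N -> divides (x N) (x n).
Proof.
move=> accp x0 xS.
case: (accp (fun n => principal_ideal (x n))).
- split=> n; first by exists (x n).
  exact: divides_principal_ideal.
- by exists 0%N; rewrite x0.
move=> N IN; exists N => n /IN eqI.
by apply: principal_ideal_divides; rewrite eqI.
Qed.

(** Terms of an ideal chain before [b + H] do not affect stabilization, so divisor chains starting
    at [b] suffice. The quotients [a] are made explicit so that single elements can later be
    followed through the decompositions. *)
Lemma chain_satisfies_ACCP b :
    (forall x a, x 0%N = b -> (forall n, x n = x n.+1 + a n) ->
      exists N, forall n, (N <= n)%N -> divides (x N) (x n)) ->
  satisfies_ACCP b.
Proof.
move=> chain I [prinI incI] [m Im].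
have [g gP] := choice prinI.
(* The generator chosen for [I m] is replaced by [b], so that the sequence starts at [b] itself. *)
pose x n := if n is 0 then b else g (m + n)%N.
have Ix n : I (m + n)%N = principal_ideal (x n).
  by case: n => [|n]; rewrite ?addn0 ?Im ?gP.
have xS n : divides (x n.+1) (x n).
  by apply: principal_ideal_divides; rewrite -!Ix addnS; apply: incI.
have [a aP] := choice xS.
have [N NP] := chain x a erefl aP.
have incIle i j : (i <= j)%N -> (I i `<=` I j)%classic.
  by move=> /subnK <-; elim: (j - i)%N => //= k IHk; exact: subset_trans IHk (incI _).
exists (m + N)%N => n leNn; apply/seteqP; split; last exact: incIle.
have -> : n = (m + (n - m))%N by rewrite subnKC // (leq_trans _ leNn) ?leq_addr.
rewrite !Ix; apply: divides_principal_ideal; apply: NP.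
by rewrite leq_subRL // (leq_trans _ leNn) ?leq_addr.
Qed.

End DivisorChains.

(** The least value of [f] is attained, and [f] cannot leave it afterwards. *)
Lemma nonincreasing_stationary (f : nat -> nat) :
    (forall n, (f n.+1 <= f n)%N) ->
  exists N, forall n, (N <= n)%N -> f n = f N.
Proof.
move=> fS.
have le_f i j : (i <= j)%N -> (f j <= f i)%N.
  by move=> /subnK <-; elim: (j - i)%N => // k; apply: leq_trans (fS _).
have ex_f : exists k, `[< exists n, f n = k >].
  by exists (f 0%N); apply/asboolP; exists 0%N.
case: (ex_minnP ex_f) => _ /asboolP[N <-] minN; exists N => n leNn.
by apply/eqP; rewrite eqn_leq le_f // minN //; apply/asboolP; exists n.
Qed.

Lemma seq_max (T : eqType) (le : rel T) (x : T) (s : seq T) :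
    total le -> transitive le ->
  exists2 m, m \in x :: s & forall y, y \in x :: s -> le y m.
Proof.
move=> tot tr; have lexx y : le y y by have := tot y y; rewrite orbb.
elim: s x => [|z s IHs] x.
  by exists x => [|y]; rewrite inE // => /eqP->.
have [m mzs maxm] := IHs z.
have [lexm|lemx] := orP (tot x m).
  exists m => [|y]; first by rewrite inE mzs orbT.
  by rewrite inE => /predU1P[->|/maxm].
exists x => [|y]; first by rewrite inE eqxx.
by rewrite inE => /predU1P[->|/maxm leym] //; apply: tr lemx.
Qed.

(** * Cancellation and cardinalities of sumsets *)

Section OrderedPowerMonoid.
Variable M : nmodType.
Hypothesis hM : linearly_orderable M.
Implicit Types (a b c d t : M) (S T A B : pfin M).

(** Distinct elements are strictly comparable and translation preserves the strict order, hence also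
    distinctness. *)
Lemma ordered_addIr d : injective (fun b => b + d).
Proof.
case: hM => le /= [tot anti _ mono] b c /= eq_bc.
case: (eqVneq b c) => // neq_bc; case/orP: (tot b c) => lebc.
  by have := mono b c d (introT andP (conj neq_bc lebc)); rewrite eq_bc eqxx.
rewrite eq_sym in neq_bc.
by have := mono c b d (introT andP (conj neq_bc lebc)); rewrite eq_bc eqxx.
Qed.

Lemma pfinDP S T z :
  reflect (exists x y, [/\ x \in pfin_val S, y \in pfin_val T & z = x + y])
          (z \in pfin_val (S + T)).
Proof. exact: sumsetP. Qed.

Definition pfin1 a : pfin M := Pfin (pfin1_neq0 a).

Lemma pfin1D a b : pfin1 (a + b) = pfin1 a + pfin1 b.
Proof.
apply/val_inj/fsetP => z /=; apply/idP/sumsetP.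
  by rewrite inE => /eqP->; exists a, b; rewrite !inE !eqxx.
by move=> [x [y []]]; rewrite !inE => /eqP-> /eqP-> ->.
Qed.

Lemma pfin1_sum (l : seq M) :
  pfin1 (\sum_(a <- l) a) = \sum_(X <- map pfin1 l) X.
Proof.
elim: l => [|a l IHl]; first by rewrite !big_nil.
by rewrite /= !big_cons pfin1D IHl.
Qed.

Lemma translate_sub T A a : a \in pfin_val A ->
  [fset x + a | x in pfin_val T] `<=` pfin_val (T + A).
Proof.
move=> aA; apply/fsubsetP => _ /imfsetP[x /= xT ->].
by apply/pfinDP; exists x, a.
Qed.

Lemma card_translate T a :
  #|` [fset x + a | x in pfin_val T] | = #|` pfin_val T|.
Proof. by apply: card_imfset; apply: ordered_addIr. Qed.

Lemma leq_card_pfinD T A : (#|` pfin_val T| <= #|` pfin_val (T + A)%R|)%N.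
Proof.
have /fset0Pn[a aA] := pfin_neq0 A.
by rewrite -(card_translate T a) fsubset_leq_card ?translate_sub.
Qed.

(* If b < c were both in A, then T + b would exhaust T + A, yet max T + c is
   larger than every element of T + b. *)
Lemma card_pfinD_singleton T A a :
    (#|` pfin_val (T + A)%R| <= #|` pfin_val T|)%N -> a \in pfin_val A ->
  A = pfin1 a.
Proof.
move=> leTA aA.
have no_lt le b c : total le -> antisymmetric le -> transitive le ->
    (forall b c d : M, (b != c) && le b c ->
      (b + d != c + d) && le (b + d) (c + d)) ->
    b \in pfin_val A -> c \in pfin_val A -> b != c -> le b c -> False.
  move=> tot anti tr mono bA cA neq_bc le_bc.
  have /eqP eqTA : [fset x + b | x in pfin_val T] == pfin_val (T + A).
    by rewrite eqEfcard translate_sub ?card_translate.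
  have [m mT maxm] : exists2 m, m \in pfin_val T &
      forall y, y \in pfin_val T -> le y m.
    have /fset0Pn[x0 x0T] := pfin_neq0 T.
    have [m] := seq_max x0 (enum_fset (pfin_val T)) tot tr.
    rewrite inE => m_in maxm; exists m.
      by case/predU1P: m_in => [->|].
    by move=> y yT; apply: maxm; rewrite inE yT orbT.
  have : m + c \in pfin_val (T + A) by apply/pfinDP; exists m, c.
  rewrite -eqTA => /imfsetP[x /= xT eq_mc].
  (* Since [m + c = x + b] with [x] at most [m], this would give
     [m + b < m + c = x + b <= m + b]. *)
  have /andP[] := mono b c m (introT andP (conj neq_bc le_bc)).
  rewrite ![_ + m]addrC eq_mc => neq le_mb.
  have /eqP[] := neq; apply: anti; rewrite le_mb /=.
  have [->|neq_xm] := eqVneq x m.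
    by have := tot (m + b) (m + b); rewrite orbb.
  by have /andP[] := mono x m b (introT andP (conj neq_xm (maxm _ xT))).
apply/val_inj/fsetP => b /=; rewrite inE; apply/idP/eqP => [bA|-> //].
case: hM => le /= [tot anti tr mono]; apply/eqP/negPn/negP => neq_ba.
case/orP: (tot b a) => leba; first exact: (no_lt le b a).
by apply: (no_lt le a b) => //; rewrite eq_sym.
Qed.

(** Each summand has at least [1 = |A + B|] elements, so [card_pfinD_singleton] applies to both.
    Thus singletons form a divisor-closed copy of [M], which lets units and atoms be compared. *)
Lemma pfinD_eq1 A B c : A + B = pfin1 c ->
  exists a b, [/\ A = pfin1 a, B = pfin1 b & c = a + b].
Proof.
move=> eqAB.
have /fset0Pn[a aA] := pfin_neq0 A; have /fset0Pn[b bB] := pfin_neq0 B.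
have le1 X : (#|` pfin_val (A + B)%R| <= #|` pfin_val X|)%N.
  rewrite eqAB cardfs1 lt0n cardfs_eq0; exact: pfin_neq0.
exists a, b; split.
- by apply: (@card_pfinD_singleton B); rewrite // addrC.
- exact: (@card_pfinD_singleton A).
have : a + b \in pfin_val (A + B) by apply/pfinDP; exists a, b.
by rewrite eqAB inE => /eqP.
Qed.

(** * Units and atoms among the singletons *)

Lemma invertible_pfin1 a : invertible a -> invertible (pfin1 a).
Proof. by case=> b ab0; exists (pfin1 b); rewrite -pfin1D ab0. Qed.

Lemma pfin1_invertible a : invertible (pfin1 a) -> invertible a.
Proof.
case=> B; rewrite -[0]/(pfin1 0) => /pfinD_eq1[a' [b [eqa _ ab0]]]; exists b.
have : a \in pfin_val (pfin1 a') by rewrite -eqa inE.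
by rewrite inE => /eqP->.
Qed.

Lemma atom_pfin1 a : atom a -> atom (pfin1 a).
Proof.
case=> nua irr; split=> [/pfin1_invertible //|B C /esym/pfinD_eq1].
by case=> b [c [-> -> /irr[]/invertible_pfin1]]; [left|right].
Qed.

Lemma atomic_pfin1 a : atomic a -> atomic (pfin1 a).
Proof.
case=> [/invertible_pfin1|[l atl ->]]; first by left.
right; exists (map pfin1 l); last exact: pfin1_sum.
by move=> _ /mapP[b /atl/atom_pfin1 atb ->].
Qed.

(** * Lifting the ACCP from an element to a set containing it *)

Lemma satisfies_ACCP_pfin T t :
  t \in pfin_val T -> satisfies_ACCP t -> satisfies_ACCP T.
Proof.
move=> tT accp; apply: chain_satisfies_ACCP => X A X0 XS.
have [N cardN] : exists N, forall n, (N <= n)%N ->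
    #|` pfin_val (X n)| = #|` pfin_val (X N)|.
  apply: (@nonincreasing_stationary (fun n => #|` pfin_val (X n)|)) => n.
  by rewrite [X in (_ <= #|` pfin_val X|)%N]XS leq_card_pfinD.
(* Dependent choice: a pair holds an index and the current element. The default 0, for elements
   outside [X n], is never reached. *)
have step (p : nat * M) : exists y, p.2 \in pfin_val (X p.1) ->
    y \in pfin_val (X p.1.+1) /\ exists2 a, a \in pfin_val (A p.1) & p.2 = y + a.
  case: (boolP (p.2 \in pfin_val (X p.1))) => [|_]; last by exists 0.
  rewrite {1}XS => /pfinDP[y [a [yX aA eqp]]].
  by exists y => _; split=> //; exists a.
have [f fP] := choice step.
pose x := fix x n := if n is n'.+1 then f (n', x n') else t.
have xX n : x n \in pfin_val (X n).
  by elim: n => [|n /(fP (n, _))[]] //=; rewrite X0.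
have xS n : exists2 a, a \in pfin_val (A n) & x n = x n.+1 + a.
  by have [] := fP (n, x n) (xX n).
have [K divK] : exists K, forall n, (K <= n)%N -> divides (x K) (x n).
  apply: (satisfies_ACCP_chain accp) => // n.
  by have [a _ ->] := xS n; exists a.
pose m := maxn N K; exists m => n le_mn.
(* The steps from [m] to [n] are summed in both chains at once, which keeps the difference [b]
   inside [B]. *)
have [B [b [bB eqX eqx]]] : exists B b,
    [/\ b \in pfin_val B, X m = X n + B & x m = x n + b].
  rewrite -(subnK le_mn); elim: (n - m)%N => [|k [B [b [bB eqX eqx]]]].
    by exists (pfin1 0), 0; rewrite inE eqxx -[pfin1 0]/(0 : pfin M) !addr0.
  have [a aA eqa] := xS (k + m)%N; exists (A (k + m)%N + B), (a + b); split.
  - by apply/pfinDP; exists a, b.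
  - by rewrite eqX XS addrA.
  - by rewrite eqx eqa addrA.
have cardm k : (m <= k)%N -> #|` pfin_val (X k)| = #|` pfin_val (X N)|.
  by move=> lemk; rewrite cardN // (leq_trans _ lemk) ?leq_maxl.
have eqB : B = pfin1 b.
  by apply: (@card_pfinD_singleton (X n)); rewrite // -eqX !cardm.
(* With [x K = x m + g], [x n = x K + e'] and [x m = x n + b], cancelling [x n] leaves
   [b + g + e' = 0]. *)
have [e eqe] : exists e, b + e = 0.
  have [e' eqe'] := divK n (leq_trans (leq_maxr _ _) le_mn).
  have [g eqg] : exists g, x K = x m + g.
    have leKm : (K <= m)%N by rewrite leq_maxr.
    rewrite -(subnK leKm); elim: (m - K)%N => [|k [g ->]].
      by exists 0; rewrite addr0.
    by have [a _ ->] := xS (k + K)%N; exists (a + g); rewrite addrA.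
  exists (g + e'); apply: (@ordered_addIr (x n)); rewrite add0r.
  by rewrite [RHS]eqe' eqg eqx !addrA [b + _ + _ + _]addrC !addrA.
exists (pfin1 e).
by rewrite eqX eqB -addrA -pfin1D eqe -[pfin1 0]/(0 : pfin M) addr0.
Qed.

(** * Common divisors of a family and of its union *)

(** [T] collects a quotient by [d] for each element of [S]. Quotients are unique by cancellation, so
    a prescribed ACCP element [t] with [d + t] in [S] does lie in [T]. *)
Lemma divides_pfin1 d S :
  (forall s, s \in pfin_val S -> divides d s) ->
  exists2 T, S = pfin1 d + T & forall t, d + t \in pfin_val S -> t \in pfin_val T.
Proof.
move=> divS.
have /choice[f fP] : forall s, exists t, s \in pfin_val S -> s = d + t.
  move=> s; case: (boolP (s \in pfin_val S)) => [/divS[t ->]|_].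
    by exists t.
  by exists 0.
have T_neq0 : [fset f s | s in pfin_val S] != fset0.
  have /fset0Pn[s sS] := pfin_neq0 S.
  by apply/fset0Pn; exists (f s); apply/imfsetP; exists s.
exists (Pfin T_neq0) => [|t dtS /=]; last first.
  apply/imfsetP; exists (d + t) => //=; apply: (@ordered_addIr d).
  by rewrite ![_ + d]addrC -fP.
apply/val_inj/fsetP => z; apply/idP/pfinDP.
  move=> zS; exists d, (f z); rewrite inE eqxx -fP //; split=> //.
  by apply/imfsetP; exists z.
by move=> [_ [_ [/fset1P-> /imfsetP[s /= sS ->] ->]]]; rewrite -fP.
Qed.

(** [U] is the union of the family. It is fixed before [d], [s] and [t], so that either hypothesis
    on [M] can be applied to it; the atomicity of [d] is handled separately. *)
Lemma pfin_common_divisor (SS : {fset pfin M}) : SS != fset0 ->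
  exists2 U : {fset M}, U != fset0 & forall d s t, common_divisor d U ->
    s \in U -> s = d + t -> satisfies_ACCP t ->
    exists S T, [/\ common_divisor (pfin1 d) SS, S \in SS, S = pfin1 d + T
                  & satisfies_ACCP T].
Proof.
move=> SS_neq0; pose U := \bigcup_(S <- enum_fset SS) pfin_val S.
have UP s : reflect (exists2 S, S \in SS & s \in pfin_val S) (s \in U).
  apply: (iffP (bigfcupP _ _ _ _)) => [[S /andP[SSS _] sS]|[S SSS sS]].
    by exists S.
  by exists S; rewrite ?SSS.
exists U => [|d s t divU /UP[S SSS sS] eqs accp].
  have /fset0Pn[S SSS] := SS_neq0; have /fset0Pn[s sS] := pfin_neq0 S.
  by apply/fset0Pn; exists s; apply/UP; exists S.
have divS S' : S' \in SS -> forall s', s' \in pfin_val S' -> divides d s'.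
  by move=> SSS' s' sS'; apply: divU; apply/UP; exists S'.
have [T eqS TP] := divides_pfin1 (divS S SSS).
exists S, T; split=> //.
  by move=> S' /divS/divides_pfin1[T' -> _]; exists T'.
by apply: satisfies_ACCP_pfin accp; apply: TP; rewrite -eqs.
Qed.

End OrderedPowerMonoid.

Theorem theorem3p3 (M : nmodType) (hM : linearly_orderable M) :
  (quasi_ACCP M -> quasi_ACCP (pfin M)) /\
  (almost_ACCP M -> almost_ACCP (pfin M)).
Proof.
split=> accp SS /(pfin_common_divisor hM)[U /accp].
  move=> [d [s [t [divU sU eqs accpt]]]] /(_ d s t divU sU eqs accpt).
  by case=> S [T [divSS SSS eqS accpT]]; exists (pfin1 d), S, T.
move=> [d [s [t [divU atd sU eqs accpt]]]] /(_ d s t divU sU eqs accpt).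
case=> S [T [divSS SSS eqS accpT]]; exists (pfin1 d), S, T; split=> //.
exact: atomic_pfin1.
Qed.
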